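(* Let $X$ and $Y$ be compact regular Hausdorff spaces. If $X$ and $Y$ are equivalent with cuts and subsequent re-glues, then $X$ and $Y$ are split homeomorphic.
   Context: Compact means that every open cover has a finite subcover (no separation axiom is included). A neighborhood of a point $p$ (respectively of a subset $S$) in a topological space is a set $V$, not necessarily open, for which there is an open set $U$ with $p \in U \subseteq V$ (respectively $S \subseteq U \subseteq V$). Let $f : X \to Y$ be a function between topological spaces and $p \in X$. The function $f$ is multi-split continuous at $p$ if there exists a finite non-empty set $Z_p \subseteq Y$ such that: (a) for every $y \in Z_p$ and all neighborhoods $U \subseteq X$ of $p$ and $V \subseteq Y$ of $y$ one has $f(U) \cap V \neq \varnothing$; (b) for every neighborhood $V \subseteq Y$ of the set $Z_p$ there exists a neighborhood $U \subseteq X$ of $p$ with $f(U) \subseteq V$. The function $f$ is globally multi-split continuous if it is multi-split continuous at every $p \in X$. A split homeomorphism is a bijection $f : X \to Y$ such that both $f$ and its inverse $f^{-1} : Y \to X$ are globally multi-split continuous. Two topological spaces $X$ and $Y$ are split homeomorphic if there exists a split homeomorphism $f : X \to Y$. Two compact regular Hausdorff spaces $X$ and $Y$ are equivalent with cuts and subsequent re-glues if there exist a compact space $Z$, two continuous finite-to-one surjections $p_X : Z \to X$ and $p_Y : Z \to Y$, and a (not necessarily continuous) right inverse $p_X^{-1} : X \to Z$ of $p_X$ (that is, $p_X \circ p_X^{-1} = \mathrm{id}_X$) such that $p_Y \circ p_X^{-1} : X \to Y$ is a bijection. A map is finite-to-one if every point of its codomain has a finite preimage. *)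

(* Defs.v *)
From mathcomp Require Import all_boot all_order all_classical.
From mathcomp Require Import topology.

Set Implicit Arguments.
Unset Strict Implicit.
Unset Printing Implicit Defensive.

Local Open Scope classical_set_scope.

(* [nbhs p V] and [set_nbhs S V] say that [V] is a not necessarily open
   neighborhood of the point [p], resp. of the set [S]; see [nbhsE] and
   [set_nbhsP] for the formulations with an intermediate open set. *)
Definition multi_split_continuous_at (X Y : topologicalType)
    (f : X -> Y) (p : X) : Prop :=
  exists Zp : set Y,
    [/\ finite_set Zp,
        Zp !=set0,
        (forall y, Zp y -> forall U V, nbhs p U -> nbhs y V ->
           f @` U `&` V !=set0)
      & (forall V, set_nbhs Zp V -> exists2 U, nbhs p U & f @` U `<=` V)].

Definition globally_multi_split_continuous (X Y : topologicalType)
    (f : X -> Y) : Prop :=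
  forall p, multi_split_continuous_at f p.

Definition split_homeomorphism (X Y : topologicalType) (f : X -> Y) : Prop :=
  exists g : Y -> X,
    [/\ cancel f g, cancel g f,
        globally_multi_split_continuous f
      & globally_multi_split_continuous g].

Definition split_homeomorphic (X Y : topologicalType) : Prop :=
  exists f : X -> Y, split_homeomorphism f.

Definition finite_to_one (A B : Type) (f : A -> B) : Prop :=
  forall b, finite_set (f @^-1` [set b]).

(* Compactness is in the sense of open covers, without separation axiom; the
   right inverse [s] of [pX] need not be continuous. *)
Definition cut_reglue_equivalent (X Y : topologicalType) : Prop :=
  exists (Z : topologicalType) (pX : Z -> X) (pY : Z -> Y) (s : X -> Z),
    [/\ cover_compact [set: Z],
        [/\ continuous pX, finite_to_one pX & set_surj [set: Z] [set: X] pX],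
        [/\ continuous pY, finite_to_one pY & set_surj [set: Z] [set: Y] pY],
        cancel s pX
      & bijective (pY \o s)].

(* Main.v *)
Require Import Defs.
From mathcomp Require Import all_boot all_order all_classical.
From mathcomp Require Import finmap topology.

Local Open Scope classical_set_scope.

(** The bijection is [f = pY \o s]. As a point [x] approaches [p] in [X], the
    lifts [s x] can accumulate in [Z] only on the fiber of [pX] over [p],
    because [pX (s x) = x] tends to [p] and limits in [X] are unique. So the
    set of cluster points of [s] at [p] is finite, and compactness of [Z] makes
    it non-empty and forces [s x] into each of its neighborhoods. Hence any
    section of a finite-to-one continuous map from a compact space to a
    Hausdorff space is multi-split continuous
    ([section_multi_split_continuous]), with these cluster points as the values
    into which it splits; composing with the continuous [pY] preserves this.

    The situation is symmetric in [X] and [Y]: if [g] is the inverse of [f],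
    then [s \o g] is a section of [pY], and [g = pX \o (s \o g)]. The same
    argument therefore gives multi-split continuity of [g]. *)

(** Points outside the cluster set have a neighborhood that the filter
    eventually leaves; together with [W] these neighborhoods cover the space,
    and a finite subcover leaves the filter nowhere to go but into [W]. *)
Lemma cover_compact_cluster_nbhs {Z : topologicalType} {F : set_system Z}
    {FF : Filter F} {W : set Z} :
  cover_compact [set: Z] -> set_nbhs (cluster F) W -> F W.
Proof.
move=> compZ clW.
(* The sets [B] used in the cover are those in which the filter eventually
   lies in [W]; this treats [W] and the sets that [F] avoids alike. *)
have [z _|D' D'sub D'cov] :=
  compZ (set Z) [set B | open B /\ F (~` B `|` W)] id (fun B => @proj1 _ _).
  have [/clW Wz|] := pselect (cluster F z).
    exists W°; last exact: Wz.
    split; first exact: open_interior.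
    apply: filterE => x; have [|] := pselect (W° x); last by left.
    by move/interior_subset; right.
  move=> nclz; apply: contrapT => ncov; apply: nclz => A V FA.
  rewrite nbhsE => -[B [oB Bz] BV].
  apply: contrapT => AV0; apply: ncov; exists B => //; split=> //.
  apply: filterS FA => x Ax; left => /BV Vx.
  by apply: AV0; exists x.
have FD' : F (\bigcap_(B in [set` D']) (~` B `|` W)).
  by apply: filter_bigI => B /D'sub /set_mem[].
apply: filterS FD' => x Dx.
by have [B BD Bx] := D'cov x I; have [] := Dx B BD.
Qed.

Lemma cover_compact_cluster_neq0 {Z : topologicalType} {F : set_system Z}
    {FF : ProperFilter F} :
  cover_compact [set: Z] -> cluster F !=set0.
Proof.
move=> compZ; apply/set0P/negP => /eqP cl0.
apply: (filter_not_empty F).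
by apply: cover_compact_cluster_nbhs => //; rewrite cl0 => z [].
Qed.

(** Continuity of [pX] pushes a cluster point of [s] at [p] to a cluster point
    of the identity at [p], and the only such point is [p] itself. *)
Lemma cluster_section_fiber {X Z : topologicalType} {pX : Z -> X} {s : X -> Z}
    (p : X) :
  hausdorff_space X -> continuous pX -> cancel s pX ->
  cluster (s @ p) `<=` pX @^-1` [set p].
Proof.
move=> hausX cpX sK z clz; apply/esym/hausX => A B pA zB.
have [||_ [[x Ax <-] Bx]] := clz (s @` A) (pX @^-1` B).
- by apply: filterS pA => x Ax; exists x.
- exact: cpX.
by exists x; split=> //; rewrite -[x]sK.
Qed.

Lemma section_multi_split_continuous {X Z : topologicalType} {pX : Z -> X}
    {s : X -> Z} :
  cover_compact [set: Z] -> hausdorff_space X ->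
  continuous pX -> finite_to_one pX -> cancel s pX ->
  globally_multi_split_continuous s.
Proof.
move=> compZ hausX cpX fpX sK p; exists (cluster (s @ p)); split.
- exact: sub_finite_set (cluster_section_fiber p hausX cpX sK) (fpX p).
- exact: cover_compact_cluster_neq0.
- move=> z clz U V pU zV; apply: clz zV.
  by apply: filterS pU => x Ux; exists x.
- move=> V clV; exists (s @^-1` V); last exact: image_preimage_subset.
  exact: (cover_compact_cluster_nbhs compZ clV).
Qed.

Lemma multi_split_continuous_comp {X Y Z : topologicalType} {s : X -> Z}
    {q : Z -> Y} :
  continuous q -> globally_multi_split_continuous s ->
  globally_multi_split_continuous (q \o s).
Proof.
move=> cq ms p; have [S [finS S0 Sa Sb]] := ms p.
exists (q @` S); split.
- exact: finite_image.
- exact: image_nonempty.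
- move=> _ [z Sz <-] U V pU zV.
  have [_ [[x Ux <-] Vx]] := Sa z Sz U (q @^-1` V) pU (cq z V zV).
  by exists (q (s x)); split=> //; exists x.
- move=> V SV; have [z Sz|U pU UV] := Sb (q @^-1` V).
    by apply: cq; apply: SV; exists z.
  by exists U => // _ [x Ux <-]; apply: (UV (s x)); exists x.
Qed.

Theorem proposition7p5 (X Y : topologicalType)
    (compX : cover_compact [set: X]) (regX : regular_space X)
    (hausX : hausdorff_space X)
    (compY : cover_compact [set: Y]) (regY : regular_space Y)
    (hausY : hausdorff_space Y) :
  cut_reglue_equivalent X Y -> split_homeomorphic X Y.
Proof.
move=> [Z [pX [pY [s [compZ [cpX fpX _] [cpY fpY _] sK [g fK gK]]]]]].
exists (pY \o s), g; split=> //.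
  apply: multi_split_continuous_comp => //.
  exact: section_multi_split_continuous sK.
have -> : g = pX \o (s \o g) by apply: funext => y /=; rewrite sK.
apply: multi_split_continuous_comp => //.
exact: (section_multi_split_continuous (pX := pY)).
Qed.
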